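(* Let $X_1,\dots,X_d$ be independent Gaussian random variables, $X_j\sim\mathcal{N}(\mu_j,\sigma_j^2)$ with $\sigma_j>0$, and let $Y=g(\mathbf{X})=\sum_{j=1}^d a_jX_j$ be a linear function of $\mathbf{X}=(X_1,\dots,X_d)$ with real coefficients $a_j$. Let $i\in\{1,\dots,d\}$ with $a_i\neq0$. Put $H_{T_i}=\mathbb{E}[H(Y\mid\mathbf{X}_{\sim i})]$, $V_{T_i}=\mathbb{E}[V(Y\mid\mathbf{X}_{\sim i})]$ and $\nu_i=\mathbb{E}\big[(\partial g(\mathbf{X})/\partial x_i)^2\big]$. Then $$e^{2H_{T_i}}=2\pi e\,V_{T_i},\qquad e^{2H(X_i)}=2\pi e\,\sigma_i^2 ,$$ and consequently the entropy upper bound $e^{2H_{T_i}}\le e^{2H(X_i)}\,\nu_i$ is equivalent to the variance upper bound $V_{T_i}\le\sigma_i^2\,\nu_i$.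
   Context: All logarithms are natural. For a continuous random variable $Z$ with density $f$, the differential entropy is $H(Z)=-\int f(z)\ln f(z)\,dz$. $\mathbf{X}_{\sim i}$ denotes the vector of all inputs $X_1,\dots,X_d$ except $X_i$. $V(Y\mid\mathbf{X}_{\sim i})$ is the conditional variance of $Y$ given $\mathbf{X}_{\sim i}$, and $\mathbb{E}[H(Y\mid\mathbf{X}_{\sim i})]$ is the expectation over $\mathbf{X}_{\sim i}$ of the differential entropy of the conditional distribution of $Y$ given $\mathbf{X}_{\sim i}=\mathbf{x}_{\sim i}$. In the formula $2\pi e$, $e$ is Euler's number. *)

(* Defs.v *)
From HB Require Import structures.
From mathcomp Require Import all_boot all_order all_algebra.
From mathcomp Require Import all_classical all_reals all_analysis.

Set Implicit Arguments.
Unset Strict Implicit.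
Unset Printing Implicit Defensive.

Import Order.TTheory GRing.Theory Num.Theory.
Import numFieldNormedType.Exports.

Local Open Scope classical_set_scope.
Local Open Scope ring_scope.
Local Open Scope ereal_scope.

Section independence.
Context d d' (T : measurableType d) (T' : measurableType d') (R : realType).

Definition mutually_independent (P : probability T R) (I : finType)
    (X : I -> {RV P >-> T'}) : Prop :=
  forall (J : {set I}) (B : I -> set T'),
    (forall j, j \in J -> measurable (B j)) ->
    P (\bigcap_(j in [set` J]) (X j @^-1` B j)) =
    \prod_(j in J) P (X j @^-1` B j).

End independence.
Arguments mutually_independent {d d' T T' R} P {I} X.

Section normal_law.
Context d (T : measurableType d) (R : realType).

(* [s] is the standard deviation. *)
Definition normally_distributed (P : probability T R) (X : {RV P >-> R})
    (m s : R) : Prop :=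
  forall A, measurable A -> distribution P X A = normal_prob m s A.

End normal_law.
Arguments normally_distributed {d T R} P X m s.

Section conditional_distribution.
Context d d1 d2 (T : measurableType d) (T1 : measurableType d1)
  (T2 : measurableType d2) (R : realType).
Variable P : probability T R.
Variables (Z : {RV P >-> T1}) (Y : {RV P >-> T2}).

(* A Markov kernel is encoded as a measurable map into the space of
   probability measures. *)
Definition is_cond_distribution (k : {mfun T1 >-> pprobability T2 R}) : Prop :=
  forall (A : set T1) (B : set T2), measurable A -> measurable B ->
    P (Z @^-1` A `&` Y @^-1` B) = \int[distribution P Z]_(z in A) k z B.

(* [cond_distribution z] is the law of [Y] given [Z = z]: a regular version,
   unique up to a null set for the law of [Z]. The default value (the law of
   [Y]) is only used when there is no regular version, which cannot happen
   for a real-valued [Y]. *)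
Definition cond_distribution : {mfun T1 >-> pprobability T2 R} :=
  xget (cst (distribution P Y : probability T2 R)
          : {mfun T1 >-> pprobability T2 R})
    [set k | is_cond_distribution k].

End conditional_distribution.
Arguments is_cond_distribution {d d1 d2 T T1 T2 R} P Z Y k.
Arguments cond_distribution {d d1 d2 T T1 T2 R} P Z Y.

Section entropy_variance.
Context (R : realType).

Definition is_density (nu : probability R R) (f : R -> R) : Prop :=
  [/\ measurable_fun [set: R] f, forall x, (0 <= f x)%R &
      forall A, measurable A ->
        nu A = \int[lebesgue_measure]_(x in A) (f x)%:E].

(* Some density of [nu], unique up to a Lebesgue-null set; the default value 0
   is only used when [nu] is not absolutely continuous. *)
Definition density (nu : probability R R) : R -> R :=
  xget (cst 0%R) [set f | is_density nu f].

(* [ln 0 = 0] here, so the integrand vanishes where the density does. *)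
Definition diff_entropy (nu : probability R R) : \bar R :=
  - \int[lebesgue_measure]_x (density nu x * ln (density nu x))%:E.

Context d d1 (T : measurableType d) (T1 : measurableType d1).

Definition entropy (P : probability T R) (X : {RV P >-> R}) : \bar R :=
  diff_entropy (distribution P X).

Definition cond_entropy (P : probability T R) (Z : {RV P >-> T1})
    (Y : {RV P >-> R}) (z : T1) : \bar R :=
  diff_entropy (cond_distribution P Z Y z).

Definition cond_variance (P : probability T R) (Z : {RV P >-> T1})
    (Y : {RV P >-> R}) (z : T1) : \bar R :=
  variance (cond_distribution P Z Y z) idfun.

End entropy_variance.
Arguments entropy {R d T} P X.
Arguments cond_entropy {R d d1 T T1} P Z Y z.
Arguments cond_variance {R d d1 T T1} P Z Y z.

Section omit.
Context d d' (T : measurableType d) (T' : measurableType d') (R : realType).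
Variables (P : probability T R) (n : nat) (X : 'I_n -> {RV P >-> T'}).

(* [lift i] enumerates in increasing order the indices different from [i]. *)
Definition omit (i : 'I_n) (w : T) : n.-1.-tuple T' :=
  [tuple X (lift i j) w | j < n.-1].

Let measurable_omit (i : 'I_n) : measurable_fun [set: T] (omit i).
Proof.
apply/measurable_fun_tnthP => j.
rewrite (_ : _ \o _ = X (lift i j)); first exact: measurable_funPT.
by apply/funext => w /=; rewrite tnth_mktuple.
Qed.

HB.instance Definition _ (i : 'I_n) :=
  isMeasurableFun.Build _ _ _ _ (omit i) (measurable_omit i).

End omit.
Arguments omit {d d' T T' R} P {n} X i w.

Section total_effects.
Context d (T : measurableType d) (R : realType).
Variables (P : probability T R) (n : nat) (X : 'I_n -> {RV P >-> R}).
Variables (Y : {RV P >-> R}) (i : 'I_n).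

Definition total_entropy : \bar R :=
  \int[P]_w cond_entropy P (omit P X i) Y (omit P X i w).

Definition total_variance : \bar R :=
  \int[P]_w cond_variance P (omit P X i) Y (omit P X i w).

End total_effects.
Arguments total_entropy {d T R} P {n} X Y i.
Arguments total_variance {d T R} P {n} X Y i.

Definition deriv_measure d (T : measurableType d) (R : realType)
    (P : probability T R) (n : nat) (X : 'I_n -> {RV P >-> R})
    (g : 'rV[R]_n -> R) (i : 'I_n) : \bar R :=
  'E_P[fun w => ('D_(delta_mx 0 i) g (\row_j X j w) ^+ 2)%R].
Arguments deriv_measure {d T R} P {n} X g i.

(* Main.v *)
(** Given the other inputs, [Y] is [a_i X_i] plus a constant, hence, [X_i] being
    independent of them, normal with standard deviation [|a_i| sigma_i]
    whatever their values. A normal law of standard deviation [s] has entropy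
    [ln (2 pi e s^2) / 2] and variance [s^2], so [cond_entropy] and
    [cond_variance] are almost surely constant; moreover [nu_i = a_i^2], and the
    two upper bounds differ by the factor [2 pi e]. *)

From HB Require Import structures.
Require Import Defs.
From mathcomp Require Import all_boot all_order all_algebra.
From mathcomp Require Import all_classical all_reals all_analysis.
From mathcomp Require Import measurable_realfun ring lra.
Import Order.TTheory GRing.Theory Num.Theory.
Import numFieldNormedType.Exports.

Set Implicit Arguments.
Unset Strict Implicit.
Unset Printing Implicit Defensive.

Import HBNNSimple.

Local Open Scope classical_set_scope.
Local Open Scope ring_scope.

(* Unification cannot find the hypothesis [mf] of the measure structure of
   [pushforward m f], which is therefore named explicitly. *)
Definition pushforward_measure d d' (T1 : measurableType d)
    (T2 : measurableType d') (R : realFieldType)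
    (m : {measure set T1 -> \bar R}) (f : T1 -> T2)
    (mf : measurable_fun [set: T1] f) : {measure set T2 -> \bar R} :=
  measure_function_pushforward__canonical__measure_function_Measure m mf.

(** * Lebesgue measure under affine maps *)

Section affine.
Context {R : realType}.
Notation leb := (@lebesgue_measure R).

Lemma measurable_affine (a b : R) :
  measurable_fun [set: R] (fun x : R => a * x + b).
Proof. by apply: measurable_funD => //; exact: measurable_funM. Qed.

(** Lebesgue measure is determined by its values on half-open intervals, so it suffices to compare
    the two sides there. *)
Lemma lebesgue_measure_affine (a b : R) (A : set R) : a != 0 -> measurable A ->
  leb A = (`|a|%:E *
    pushforward leb ((fun x => a * x + b)%R : _ -> measurableTypeR R) A)%E.
Proof.
move=> a0 mA.
pose phi : measurableTypeR R -> measurableTypeR R := fun x => a * x + b.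
pose k : {nonneg R} := NngNum (normr_ge0 a).
pose nu := @pushforward_measure _ _ _ _ _ leb phi (measurable_affine a b).
apply: (@lebesgue_measure_unique R (mscale k nu) _ A mA).
move=> _ [[x y]] _ <-; rewrite /= /mscale/= /pushforward lebesgue_measure_itv/=.
have [a_gt0|] := ltP 0 a; last rewrite le_eqVlt (negPf a0)/= => a_lt0.
- have -> : phi @^-1` `]x, y]%classic = `](x - b) / a, (y - b) / a]%classic.
    apply/seteqP; split=> z /=; rewrite !in_itv/= /phi.
      by rewrite ltr_pdivrMr// ler_pdivlMr// ltrBlDr lerBrDr mulrC.
    by rewrite ltr_pdivrMr// ler_pdivlMr// ltrBlDr lerBrDr mulrC.
  rewrite lebesgue_measure_itv/= !lte_fin ltr_pM2r ?invr_gt0// ltrD2r.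
  case: ifP => xy; last by rewrite mule0.
  by rewrite -!EFinB -EFinM gtr0_norm//; congr EFin; field.
(* A negative slope reverses the interval, so the closed end changes sides. *)
- have -> : phi @^-1` `]x, y]%classic = `[(y - b) / a, (x - b) / a[%classic.
    apply/seteqP; split=> z /=; rewrite !in_itv/= /phi.
      by rewrite ler_ndivrMr// ltr_ndivlMr// ltrBlDr lerBrDr mulrC andbC.
    by rewrite ler_ndivrMr// ltr_ndivlMr// ltrBlDr lerBrDr mulrC andbC.
  rewrite lebesgue_measure_itv/= !lte_fin ltr_nM2r ?invr_lt0// ltrD2r.
  case: ifP => xy; last by rewrite mule0.
  by rewrite -!EFinB -EFinM ltr0_norm//; congr EFin; field.
Qed.

Lemma ge0_integral_affine (a b : R) (f : R -> \bar R) : a != 0 ->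
  measurable_fun [set: R] f -> (forall x, 0 <= f x)%E ->
  (\int[leb]_x f x = `|a|%:E * \int[leb]_x f (a * x + b)%R)%E.
Proof.
move=> a0 mf f0.
pose phi : measurableTypeR R -> measurableTypeR R := fun x => a * x + b.
pose k : {nonneg R} := NngNum (normr_ge0 a).
pose nu := @pushforward_measure _ _ _ _ _ leb phi (measurable_affine a b).
rewrite (eq_measure_integral (mscale k nu)); last first.
  move=> A mA _; exact: (@lebesgue_measure_affine a b).
rewrite (ge0_integral_mscale _ _ k)//; congr (_ * _)%E.
rewrite (@ge0_integral_pushforward _ _ _ _ _ phi)//=.
exact: (measurable_affine a b).
Qed.

End affine.

(** * Second moment of the Gaussian function *)

Section gauss_moment.
Context {R : realType}.
Notation leb := (@lebesgue_measure R).
Import gauss_integral_proof.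

(** The known limit is that of the square; [integral0_gauss] is nonnegative, so a square root
    recovers it. *)
Lemma cvg_integral0_gauss :
  @integral0_gauss R x @[x --> +oo] --> Num.sqrt pi / 2.
Proof.
have : Num.sqrt (@integral0_gauss R x ^+ 2) @[x --> +oo]
    --> Num.sqrt (pi / 4).
  apply: continuous_cvg => //;
    [exact: sqrt_continuous|exact: cvg_integral0_gauss_sqr].
rewrite sqrtrM ?pi_ge0// sqrtrV// (_ : 4 = 2 ^+ 2); last first.
  by rewrite expr2 -natrM.
rewrite sqrtr_sqr ger0_norm//.
rewrite (_ : (fun _ => Num.sqrt _) = integral0_gauss)//.
by apply/funext => r; rewrite sqrtr_sqr// ger0_norm// integral0_gauss_ge0.
Qed.

Lemma derivable_integral0_gauss (x : R) : 0 < x ->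
  derivable integral0_gauss x 1 /\
  (integral0_gauss^`())%classic x = gauss_fun x.
Proof.
move=> x0.
apply: (@continuous_FTC1 R gauss_fun (BLeft 0) _ (x + 1)).
- by rewrite ltrDl.
- apply: continuous_compact_integrable => //; first exact: segment_compact.
  by apply: continuous_subspaceT; exact: continuous_gauss_fun.
- by rewrite /= lte_fin.
- by move=> ?; exact: continuous_gauss_fun.
Qed.

(** Squeezed between 0 and [1/x], since [x^2 <= 1 + x^2 <= exp(x^2)]. *)
Lemma cvg_mul_gauss_fun : x * gauss_fun x @[x --> +oo] --> (0 : R).
Proof.
apply: (@squeeze_cvgr _ _ _ _ (cst 0) (fun x : R => x^-1)).
- near=> x; have x0 : 0 < x by near: x; exact: nbhs_pinfty_gt.
  rewrite /= mulr_ge0 ?gauss_fun_ge0 ?(ltW x0)//= /gauss_fun expRN.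
  rewrite ler_pdivrMr ?expR_gt0// ler_pdivlMl//.
  by rewrite (le_trans _ (expR_ge1Dx _))// -expr2 lerDr.
- exact: cvg_cst.
- by apply/gtr0_cvgV0; [exact: nbhs_pinfty_gt|exact: cvg_id].
Unshelve. all: end_near. Qed.

(** Integration by parts on the half-line, doubled by evenness. *)
Lemma integral_sqr_gauss_fun :
  (\int[leb]_x (x ^+ 2 * gauss_fun x)%:E = (Num.sqrt pi / 2)%:E)%E.
Proof.
have cf : continuous (fun x : R => x ^+ 2 * gauss_fun x).
  move=> x; apply: cvgM; first exact: exprn_continuous.
  exact: continuous_gauss_fun.
rewrite ge0_symfun_integralT//=; last 2 first.
  by move=> x; rewrite mulr_ge0 ?sqr_ge0 ?gauss_fun_ge0.
  by move=> x /=; rewrite /gauss_fun sqrrN.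
rewrite -set_itvcy//.
(* Since [x * gauss_fun x] has derivative [gauss_fun x - 2 x^2 gauss_fun x], this is an
   antiderivative of the integrand. It vanishes at 0, and at infinity only the Gaussian integral
   contributes, giving [sqrt pi / 4]. *)
pose F (x : R) := (integral0_gauss x - x * gauss_fun x) / 2.
have dg (x : R) : is_derive x 1 (fun x => x * gauss_fun x)
    (gauss_fun x - 2 * (x ^+ 2 * gauss_fun x)).
  rewrite /gauss_fun; apply: trigger_derive.
  by rewrite /GRing.scale/=; ring.
have dF (x : R) : 0 < x -> is_derive x 1 F (x ^+ 2 * gauss_fun x).
  move=> x0; have [dI I'E] := derivable_integral0_gauss x0.
  have dI' : is_derive x 1 (integral0_gauss : R -> R) (gauss_fun x).
    by apply: DeriveDef => //; rewrite -derive1E.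
  rewrite (_ : F = ((integral0_gauss - (fun x : R => x * gauss_fun x)) *
    cst 2^-1)%R); last by apply/funext => y.
  have dgx := dg x; apply: is_derive_eq; rewrite /GRing.scale/=.
  by field.
rewrite (@ge0_continuous_FTC2y R _ F 0 (Num.sqrt pi / 4))//=.
- rewrite /F mul0r subr0 /integral0_gauss set_itv1 Rintegral_set1 mul0r sube0.
  by rewrite -EFinM; congr EFin; field.
- by move=> x _; rewrite mulr_ge0 ?sqr_ge0 ?gauss_fun_ge0.
- exact: continuous_subspaceT.
- rewrite (_ : Num.sqrt pi / 4 = (Num.sqrt pi / 2 - 0) / 2); last by field.
  apply: cvgM; last exact: cvg_cst.
  by apply: cvgB; [exact: cvg_integral0_gauss|exact: cvg_mul_gauss_fun].
- by move=> x /dF[].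
- apply: cvgM; last exact: cvg_cst.
  apply: cvgB.
    rewrite [X in _ --> X](_ : _ = 0); last first.
      by rewrite /integral0_gauss set_itv1 Rintegral_set1.
    apply: cvg_at_right_filter.
    apply: (@parameterized_integral_cvg_left _ 0 1) => //.
    apply: continuous_compact_integrable => //; first exact: segment_compact.
    by apply: continuous_subspaceT; exact: continuous_gauss_fun.
  apply: cvg_at_right_filter; apply: cvgM; first exact: cvg_id.
  exact: continuous_gauss_fun.
- by move=> x; rewrite in_itv/= andbT => /dF[_ <-]; rewrite derive1E.
Qed.

End gauss_moment.

(** Indicators by hypothesis, simple functions by linearity, then monotone convergence along simple
    approximations. *)
Lemma ge0_integral_density d (T : measurableType d) (R : realType)
    (m nu : {measure set T -> \bar R}) (p : T -> R)
    (mp : measurable_fun [set: T] p) (p0 : forall x, 0 <= p x)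
    (nuE : forall A, measurable A -> nu A = (\int[m]_(x in A) (p x)%:E)%E)
    (f : T -> \bar R) (mf : measurable_fun [set: T] f)
    (f0 : forall x, (0 <= f x)%E) :
  (\int[nu]_x f x = \int[m]_x (f x * (p x)%:E))%E.
Proof.
have nu_indic E : measurable E ->
    (\int[nu]_x (\1_E x)%:E = \int[m]_x ((\1_E x)%:E * (p x)%:E))%E.
  move=> mE; rewrite integral_indic// setIT nuE// integral_mkcond.
  apply: eq_integral => x _; rewrite patchE indicE.
  by case: ifP => _; rewrite ?mul1e ?mul0e.
have mpe : measurable_fun [set: T] (EFin \o p) by exact/measurable_EFinP.
have nu_nnsfun (h : {nnsfun T >-> R}) :
    (\int[nu]_x (h x)%:E = \int[m]_x ((h x)%:E * (p x)%:E))%E.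
  under [LHS]eq_integral do rewrite fimfunE -fsumEFin//.
  rewrite [LHS]ge0_integral_fsum//; last 2 first.
    - by move=> r; exact/measurable_EFinP/measurableT_comp.
    - by move=> n x _; rewrite EFinM nnfun_muleindic_ge0.
  under [RHS]eq_integral.
    move=> x xD; rewrite fimfunE -fsumEFin// muleC ge0_mule_fsumr; last first.
      by move=> r; rewrite EFinM nnfun_muleindic_ge0.
    over.
  rewrite [RHS]ge0_integral_fsum//; last 2 first.
  - move=> r; apply: emeasurable_funM => //.
    exact/measurable_EFinP/measurableT_comp.
  - move=> r x _; rewrite mule_ge0//; first by rewrite lee_fin.
    by rewrite EFinM nnfun_muleindic_ge0.
  apply: eq_fsbigr => r /set_mem[t _ <-].
  under eq_integral do rewrite EFinM.
  under [RHS]eq_integral do rewrite EFinM muleCA.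
  rewrite ge0_integralZl//; last 2 first.
  - exact/measurable_EFinP/measurable_indic.
  - by rewrite lee_fin.
  rewrite ge0_integralZl//; last 3 first.
  - apply: emeasurable_funM => //.
    exact/measurable_EFinP/measurable_indic.
  - by move=> x _; rewrite mule_ge0// lee_fin.
  - by rewrite lee_fin.
  rewrite nu_indic//; congr (_ * _)%E.
  by apply: eq_integral => x _; rewrite muleC.
pose f_ := nnsfun_approx measurableT mf.
transitivity (lim (\int[nu]_x (f_ n x)%:E @[n --> \oo])%E).
  rewrite -monotone_convergence//=.
  - apply: eq_integral => x _; apply/esym/cvg_lim => //=.
    exact: cvg_nnsfun_approx.
  - by move=> n; exact/measurable_EFinP/measurable_funTS.
  - by move=> n ? _; rewrite lee_fin.
  - by move=> ? _ ? ? mn; rewrite lee_fin; exact/lefP/nd_nnsfun_approx.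
under eq_fun do rewrite nu_nnsfun.
rewrite -monotone_convergence//=.
- apply: eq_integral => x _; apply/cvg_lim => //=.
  by apply: cvgeZr => //; exact: cvg_nnsfun_approx.
- move=> n; apply: emeasurable_funM => //.
  exact/measurable_EFinP/measurable_funTS.
- by move=> n ? _; rewrite mule_ge0// lee_fin.
- move=> x _ n k nk; rewrite lee_pmul// ?lee_fin//.
  exact/lefP/nd_nnsfun_approx.
Qed.

(** * Affine changes of variable and second moment of the normal density *)

Section normal_moments.
Context {R : realType}.
Notation leb := (@lebesgue_measure R).
Implicit Types m s a b x : R.

(** The factor [|a|] is the Jacobian. The density depends on the deviation only through its square,
    so [a] may be negative. *)
Lemma normal_pdf_affine a b m s x : a != 0 -> s != 0 ->
  `|a| * normal_pdf (a * m + b) (a * s) (a * x + b) = normal_pdf m s x.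
Proof.
move=> a0 s0; rewrite !normal_pdfE ?mulf_neq0// /normal_peak /normal_fun mulrA.
congr (_ * expR _).
  rewrite exprMn -mulrA -mulrnAr sqrtrM ?sqr_ge0// sqrtr_sqr invfM mulrA.
  by rewrite mulfV ?mul1r// normr_eq0.
rewrite (_ : a * x + b - (a * m + b) = a * (x - m)); last by ring.
rewrite !exprMn -mulrnAr -mulrN -mulf_div divff ?mul1r//.
by rewrite expf_neq0.
Qed.

Lemma ge0_integral_normal_pdf_affine a b m s (f : R -> \bar R) :
  a != 0 -> s != 0 -> measurable_fun [set: R] f -> (forall x, 0 <= f x)%E ->
  (\int[leb]_x (f x * (normal_pdf (a * m + b) (a * s) x)%:E) =
   \int[leb]_x (f (a * x + b)%R * (normal_pdf m s x)%:E))%E.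
Proof.
move=> a0 s0 mf f0.
have mpdf m' s' : measurable_fun [set: R] (EFin \o normal_pdf m' s').
  by apply/measurable_EFinP; exact: measurable_normal_pdf.
have mfp : measurable_fun [set: R]
    (fun x => f x * (normal_pdf (a * m + b) (a * s) x)%:E)%E.
  by apply: emeasurable_funM => //; exact: mpdf.
rewrite (@ge0_integral_affine _ a b)//; last first.
  by move=> x; rewrite mule_ge0// lee_fin normal_pdf_ge0.
rewrite -ge0_integralZl//; last 2 first.
- exact: measurableT_comp mfp (measurable_affine a b).
- by move=> x _; rewrite mule_ge0// lee_fin normal_pdf_ge0.
apply: eq_integral => x _.
by rewrite muleCA -EFinM normal_pdf_affine.
Qed.

(** The substitution [x = sqrt 2 * y] turns the exponent [-x^2 / 2] into [-y^2] and reduces the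
    integral to that of [gauss_fun]. *)
Lemma integral_sqr_std_normal_pdf :
  (\int[leb]_x (x ^+ 2 * normal_pdf 0 1 x)%:E = 1)%E.
Proof.
have s2 : Num.sqrt 2 != 0 :> R by rewrite gt_eqF// sqrtr_gt0.
have msqr : measurable_fun [set: R]
    (fun x : R => (x ^+ 2 * normal_pdf 0 1 x)%:E).
  apply/measurable_EFinP; apply: measurable_funM; first exact: measurable_funX.
  exact: measurable_normal_pdf.
rewrite (@ge0_integral_affine _ (Num.sqrt 2) 0)//; last first.
  by move=> x; rewrite lee_fin mulr_ge0 ?sqr_ge0 ?normal_pdf_ge0.
transitivity ((Num.sqrt 2)%:E * \int[leb]_x
    ((2 / Num.sqrt (pi * 2))%:E * (x ^+ 2 * gauss_fun x)%:E))%E.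
  rewrite ger0_norm ?sqrtr_ge0//; congr (_ * _)%E; apply: eq_integral => x _.
  rewrite -EFinM addr0 normal_pdfE ?oner_neq0// /normal_peak /normal_fun.
  rewrite expr1n mul1r subr0 exprMn sqr_sqrtr// mulNr mulrC -mulr_natr.
  rewrite (_ : 2 * x ^+ 2 / (1 *+ 2) = x ^+ 2) ?/gauss_fun; last by field.
  by congr EFin; ring.
rewrite ge0_integralZl//; last 2 first.
- apply/measurable_EFinP; apply: measurable_funM; first exact: measurable_funX.
  exact: measurable_gauss_fun.
- by move=> x _; rewrite lee_fin mulr_ge0 ?sqr_ge0 ?gauss_fun_ge0.
rewrite integral_sqr_gauss_fun -!EFinM; congr EFin.
rewrite mulrC sqrtrM ?pi_ge0//; field.
by rewrite s2 gt_eqF// sqrtr_gt0 pi_gt0.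
Qed.

Lemma integral_sqr_normal_pdf m s : s != 0 ->
  (\int[leb]_x (((x - m) ^+ 2)%:E * (normal_pdf m s x)%:E) = (s ^+ 2)%:E)%E.
Proof.
(* Standardization: the law is the image of the standard normal under [x -> s * x + m]. *)
move=> s0; have := @ge0_integral_normal_pdf_affine s m 0 1
  (fun x => ((x - m) ^+ 2)%:E) s0 (oner_neq0 _).
rewrite mulr0 add0r mulr1 => ->; last 2 first.
- apply/measurable_EFinP/measurable_funX; exact: measurable_funB.
- by move=> x; rewrite lee_fin sqr_ge0.
transitivity (\int[leb]_x ((s ^+ 2)%:E * (x ^+ 2 * normal_pdf 0 1 x)%:E))%E.
  apply: eq_integral => x _; rewrite addrK exprMn -!EFinM; by congr EFin; ring.
rewrite ge0_integralZl//.
- by rewrite integral_sqr_std_normal_pdf mule1.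
- apply/measurable_EFinP; apply: measurable_funM; first exact: measurable_funX.
  exact: measurable_normal_pdf.
- by move=> x _; rewrite lee_fin mulr_ge0 ?sqr_ge0 ?normal_pdf_ge0.
- by rewrite lee_fin sqr_ge0.
Qed.

End normal_moments.

(** * Mean and variance of a normal law *)

Section normal_law.
Context {R : realType}.
Notation leb := (@lebesgue_measure R).
Implicit Types m s x : R.

Lemma normal_pdfN m s : normal_pdf m (- s) = normal_pdf m s.
Proof.
apply/funext => x.
by rewrite /normal_pdf oppr_eq0 /normal_peak /normal_fun sqrrN.
Qed.

Variables (nu : probability R R) (m s : R).
Hypothesis s0 : s != 0.
Hypothesis nuE : forall A, measurable A -> nu A = normal_prob m s A.

Lemma ge0_integral_normal (f : R -> \bar R) :
  measurable_fun [set: R] f -> (forall x, 0 <= f x)%E ->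
  (\int[nu]_x f x = \int[leb]_x (f x * (normal_pdf m s x)%:E))%E.
Proof.
move=> mf f0.
(* [R] and [measurableTypeR R] have the same measurable sets but not the same
   display, hence the detour through [nu']. *)
have mid : measurable_fun [set: R] (idfun : R -> measurableTypeR R).
  by move=> _ A mA; rewrite setTI.
pose nu' := pushforward_measure nu mid.
rewrite -(@ge0_integral_density _ _ R leb nu' (normal_pdf m s))//; last 2 first.
- exact: measurable_normal_pdf.
- by move=> x; exact: normal_pdf_ge0.
by rewrite ge0_integral_pushforward.
Qed.

Let mcenter : measurable_fun [set: R] (fun x : R => (x - m)%:E).
Proof. by apply/measurable_EFinP; exact: measurable_funB. Qed.

Lemma integral_sqr_normal : (\int[nu]_x ((x - m) ^+ 2)%:E = (s ^+ 2)%:E)%E.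
Proof.
rewrite ge0_integral_normal ?integral_sqr_normal_pdf//.
- by apply/measurable_EFinP/measurable_funX; exact: measurable_funB.
- by move=> x; rewrite lee_fin sqr_ge0.
Qed.

(** The finite second moment dominates the first through [|t| <= 1 + t^2], which follows from
    [(|t| - 1/2)^2 >= 0]. *)
Lemma integrable_center_normal : nu.-integrable [set: R] (fun x => (x - m)%:E).
Proof.
have i2 : nu.-integrable [set: R] (fun x => ((x - m) ^+ 2)%:E).
  apply/integrableP; split.
    by apply/measurable_EFinP/measurable_funX; exact: measurable_funB.
  under eq_integral do rewrite gee0_abs ?lee_fin ?sqr_ge0//.
  by rewrite integral_sqr_normal ltry.
have i1 : nu.-integrable [set: R] (fun x => (1 : R)%:E).
  exact: finite_measure_integrable_cst.
apply: (le_integrable _ _ _ (integrableD _ i1 i2)) => //= x _.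
rewrite lee_fin [leRHS]ger0_norm ?addr_ge0 ?sqr_ge0//.
rewrite -(real_normK (num_real (x - m))).
by have := sqr_ge0 (`|x - m| - 2^-1); nra.
Qed.

(* The law is invariant under the reflection about [m]. *)
Lemma integral_center_normal : (\int[nu]_x (x - m)%:E = 0)%E.
Proof.
pose f x : \bar R := (x - m)%:E.
have fin := integrable_fin_num _ integrable_center_normal.
have pfin := integrable_pos_fin_num measurableT integrable_center_normal.
rewrite integralE -/f.
suff -> : (\int[nu]_x f^\- x = \int[nu]_x f^\+ x)%E by rewrite subee.
rewrite !ge0_integral_normal//.
(* Slope -1 and offset [2m] fix the mean [m] and send the deviation [-s] to [s]; the reflected
   negative part is the positive part. *)
- have := @ge0_integral_normal_pdf_affine R (-1) (m + m) m (- s) f^\-%E.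
  rewrite !mulN1r opprK addrA addNr add0r normal_pdfN => ->;
    rewrite ?oppr_eq0 ?oner_eq0//.
  + apply: eq_integral => x _; congr (_ * _)%E.
    by rewrite funeposE funenegE /f -EFinN; congr (maxe _%:E _); ring.
  + exact: measurable_funeneg.
- exact: measurable_funepos.
- exact: measurable_funeneg.
Qed.

Lemma mean_normal : (\int[nu]_x x%:E = m%:E)%E.
Proof.
have i1 : nu.-integrable [set: R] (fun x => m%:E).
  exact: finite_measure_integrable_cst.
transitivity (\int[nu]_x ((x - m)%:E + m%:E))%E.
  by apply: eq_integral => x _; rewrite -EFinD subrK.
rewrite integralD//; last exact: integrable_center_normal.
rewrite integral_center_normal add0e integral_cst//.
rewrite [X in (_ * X)%E](_ : _ = 1%E) ?mule1//.
exact: (@probability_setT _ _ _ nu).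
Qed.

Lemma variance_normal : variance nu idfun = (s ^+ 2)%:E.
Proof.
rewrite /variance unlock/= unlock/= mean_normal/= -integral_sqr_normal.
by apply: eq_integral => x _; rewrite /= expr2.
Qed.

End normal_law.

(** * Entropy of a normal law *)

Section density.
Context {R : realType}.
Notation leb := (@lebesgue_measure R).

(** Both functions have the same integral over every measurable set, and the total mass 1 makes them
    integrable. *)
Lemma is_density_ae_unique (nu : probability R R) (f g : R -> R) :
  is_density nu f -> is_density nu g -> ae_eq leb [set: R] f g.
Proof.
move=> [mf f0 fE] [mg g0 gE].
have := @integral_ae_eq _ _ _ leb setT measurableT (EFin \o g) (EFin \o f).
move=> H; have {}H : ae_eq leb setT (EFin \o f) (EFin \o g).
  apply: H.
  - apply/integrableP; split; first exact/measurable_EFinP.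
    under eq_integral do rewrite gee0_abs ?lee_fin//.
    by rewrite -fE// probability_setT ltry.
  - exact/measurable_EFinP.
  - by move=> E _ mE; rewrite /= -fE// -gE.
by apply: filterS H => x /[apply] -[].
Qed.

(** [density] is an arbitrary choice; almost everywhere uniqueness lets any known density take its
    place. *)
Lemma diff_entropyE (nu : probability R R) (f : R -> R) : is_density nu f ->
  diff_entropy nu = (- \int[leb]_x (f x * ln (f x))%:E)%E.
Proof.
move=> df; congr oppe.
have dd : is_density nu (density nu) by apply: (xgetPex _ (ex_intro _ f df)).
have mfln h : is_density nu h ->
    measurable_fun [set: R] (fun x => (h x * ln (h x))%:E).
  case=> mh _ _; apply/measurable_EFinP; apply: measurable_funM => //.
  exact: measurableT_comp.
apply: ae_eq_integral => //; [exact: mfln|exact: mfln|].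
by apply: filterS (is_density_ae_unique dd df) => x /[apply] ->.
Qed.

Lemma diff_entropy_normal (nu : probability R R) (m s : R) : s != 0 ->
  (forall A, measurable A -> nu A = normal_prob m s A) ->
  diff_entropy nu = (ln (2 * pi * expR 1 * s ^+ 2) / 2)%:E.
Proof.
move=> s0 nuE.
have s2 : 0 < s ^+ 2 by rewrite exprn_even_gt0.
rewrite (@diff_entropyE _ (normal_pdf m s)); last first.
  by split; [exact: measurable_normal_pdf|exact: normal_pdf_ge0|].
have i1 := integrable_normal_pdf m s.
have i2 : leb.-integrable [set: R]
    (fun x => ((x - m) ^+ 2)%:E * (normal_pdf m s x)%:E)%E.
  apply/integrableP; split.
    apply/measurable_EFinP; apply: measurable_funM.
      by apply/measurable_funX; exact: measurable_funB.
    exact: measurable_normal_pdf.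
  under eq_integral do
    rewrite gee0_abs ?mule_ge0 ?lee_fin ?sqr_ge0 ?normal_pdf_ge0//.
  by rewrite integral_sqr_normal_pdf// ltry.
(* The logarithm of the density is [ln (normal_peak s) - (x - m)^2 / (2 s^2)], so only the total
   mass and the second moment enter. *)
transitivity (- \int[leb]_x ((ln (normal_peak s))%:E * (normal_pdf m s x)%:E -
   (s ^+ 2 *+ 2)^-1%:E * (((x - m) ^+ 2)%:E * (normal_pdf m s x)%:E)))%E.
  congr oppe; apply: eq_integral => x _.
  rewrite -!EFinM -EFinB; congr EFin.
  rewrite {2}normal_pdfE// lnM ?posrE ?expR_gt0 ?normal_peak_gt0// expRK.
  by ring.
rewrite integralB//; last 2 first.
- exact: integrableZl.
- exact: integrableZl.
rewrite integralZl// integralZl// integral_normal_pdf integral_sqr_normal_pdf//.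
rewrite mule1 -EFinM -EFinB -EFinN; congr EFin.
have p0 : 0 < s ^+ 2 * pi *+ 2 :> R by rewrite mulrn_wgt0// mulr_gt0 ?pi_gt0.
rewrite /normal_peak lnV ?posrE ?sqrtr_gt0// -powR12_sqrt ?ltW// ln_powR.
(* The second moment contributes [1/2], which becomes the factor [e] inside the logarithm. *)
have -> : 2 * pi * expR 1 * s ^+ 2 = s ^+ 2 * pi *+ 2 * expR 1 by ring.
rewrite lnM ?posrE ?expR_gt0// expRK.
by field.
Qed.

End density.

(** * Integrals of almost everywhere equal functions *)

Section ae_integral.
Context d (T : measurableType d) (R : realType).
Variable mu : {measure set T -> \bar R}.
Local Open Scope ereal_scope.

(** This is how the integral of a nonnegative function is defined; the supremum makes sense without
    measurability. *)
Let nnint (f : T -> \bar R) := ereal_sup [set sintegral mu h |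
  h in [set h : {nnsfun T >-> R} | forall x, (h x)%:E <= f x]].

(** A simple function below [f] is set to zero on [N]: it then lies below [g], and its integral is
    unchanged because [N] is null. *)
Let nnint_le (f g : T -> \bar R) (N : set T) : measurable N -> mu N = 0 ->
  (forall x, 0 <= g x) -> (forall x, ~ N x -> f x <= g x) ->
  nnint f <= nnint g.
Proof.
move=> mN N0 g0 fg; apply: ge_ereal_sup => _ [h hf <-].
have mNC : measurable (~` N) by exact: measurableC.
pose h' := proj_nnsfun h mNC.
suff <- : sintegral mu h' = sintegral mu h.
  apply: ereal_sup_ubound; exists h' => // x.
  rewrite /h' /proj_nnsfun/= mindicE.
  have [xN|xN] := boolP (x \in ~` N).
    by rewrite mulr1 (le_trans (hf x))// fg//; exact: set_mem.
  by rewrite mulr0.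
rewrite -!integralT_nnsfun; apply: ge0_ae_eq_integral => //.
- by apply/measurable_EFinP.
- by apply/measurable_EFinP.
- by move=> x _; rewrite lee_fin.
- by move=> x _; rewrite lee_fin.
exists N; split => // x /= /not_implyP[_]; apply: contra_notP => Nx.
by rewrite mindicE mem_set// mulr1.
Qed.

(* The integrands of [total_entropy] and [total_variance] depend on the choices
   made by [xget], so they are not obviously measurable. *)
Lemma ae_eq_integral_nonmeasurable (f g : T -> \bar R) :
  ae_eq mu [set: T] f g -> \int[mu]_x f x = \int[mu]_x g x.
Proof.
move=> [N [mN N0 fgN]].
have fg x : ~ N x -> f x = g x.
  by apply: contra_notP => fgx; apply: fgN => /(_ I).
rewrite /integral !patch_setT.
congr (_ - _); apply/eqP; rewrite eq_le; apply/andP; split.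
all: by apply: (nnint_le mN N0) => // x Nx; rewrite ?funeposE ?funenegE fg.
Qed.

End ae_integral.

(** * Independence of one input from the others *)

Section independence_omit.
Context d d' (T : measurableType d) (T' : measurableType d') (R : realType).
Variables (P : probability T R).
Local Open Scope ereal_scope.

(** Boxes are stable under intersection, as the uniqueness theorem for measures requires; a cylinder
    over one coordinate is a box whose other sides are full. *)
Lemma measurable_tuple_rectangles n :
  @measurable _ (n.-tuple T') = <<s [set C | exists D : 'I_n -> set T',
    (forall j, measurable (D j)) /\
    C = \bigcap_(j in [set: 'I_n]) (@tnth n T' ^~ j) @^-1` D j] >>.
Proof.
set G := [set C | _]; apply/seteqP; split; last first.
  apply: smallest_sub; first exact: sigma_algebra_measurable.
  move=> _ [D [mD ->]]; apply: fin_bigcap_measurable => // j _.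
  by rewrite -[X in measurable X]setTI; exact: measurable_tnth.
apply: smallest_sub; first exact: smallest_sigma_algebra.
rewrite -bigcup_seq => C [j _ [B mB <-]].
apply: sub_sigma_algebra; rewrite setTI.
exists (fun k => if k == j then B else setT); split.
  by move=> k; case: ifP.
apply/seteqP; split=> t /=.
  by move=> Bt k _; case: ifPn => [/eqP->|].
by move=> /(_ j I); rewrite eqxx.
Qed.

Variables (n : nat) (X : 'I_n -> {RV P >-> T'}).
Hypothesis X_indep : mutually_independent P X.

(** For fixed [B] both sides are finite measures in [A], and mutual independence makes them agree on
    the pi-system of boxes. *)
Lemma omit_indep (i : 'I_n) (A : set (n.-1.-tuple T')) (B : set T') :
  measurable A -> measurable B ->
  P (omit P X i @^-1` A `&` X i @^-1` B) =
  P (omit P X i @^-1` A) * P (X i @^-1` B).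
Proof.
move=> mA mB.
have mXB : measurable (X i @^-1` B) by exact: measurable_funPTI.
have momit := measurable_funPT (omit P X i).
pose m1 := pushforward_measure (mrestr P mXB) momit.
have fB : P (X i @^-1` B) \is a fin_num by exact: fin_num_measure.
pose k : {nonneg R} := NngNum (fine_ge0 (measure_ge0 P (X i @^-1` B))).
pose m2 : {measure set (n.-1.-tuple T') -> \bar R} :=
  mscale k (pushforward_measure P momit).
have m1E C : m1 C = P (omit P X i @^-1` C `&` X i @^-1` B) by [].
have m2E C : m2 C = P (X i @^-1` B) * P (omit P X i @^-1` C).
  by rewrite /m2 /= /mscale /= fineK.
have omitE w j : tnth (omit P X i w) j = X (lift i j) w by exact: tnth_mktuple.
suff : m1 A = m2 A by rewrite m1E m2E [RHS]muleC.
apply: (measure_unique _ (fun=> setT) (measurable_tuple_rectangles n.-1)) => //.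
- move=> _ _ [D [mD ->]] [E [mE ->]]; exists (fun j => D j `&` E j); split.
    by move=> j; exact: measurableI.
  by rewrite -bigcapI.
- move=> _; exists (fun=> setT); split => //.
  by apply/seteqP; split.
- by rewrite bigcup_const//; exists 0%N.
- move=> _ [D [mD ->]].
  (* [B] sits at index [i] and the sides of the box elsewhere, so that mutual independence applies
     both to all indices and to all but [i]. *)
  pose E j := if unlift i j is Some j' then D j' else B.
  have mE j : measurable (E j) by rewrite /E; case: unliftP.
  rewrite m1E m2E.
  have -> : omit P X i @^-1` (\bigcap_(j in [set: 'I_n.-1])
      (@tnth n.-1 T' ^~ j) @^-1` D j) =
      \bigcap_(j in [set` [set~ i]%SET]) (X j @^-1` E j).
    apply/seteqP; split => w /=.
      move=> H j /=; rewrite !inE /E.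
      case: unliftP => [j' -> _|->]; last by rewrite eqxx.
      by have := H j' I; rewrite /preimage/= omitE.
    move=> H j _; rewrite /preimage/= omitE; have := H (lift i j).
    by rewrite /E /= liftK; apply; rewrite !inE eq_sym neq_lift.
  have -> : \bigcap_(j in [set` [set~ i]%SET]) (X j @^-1` E j) `&` X i @^-1` B =
      \bigcap_(j in [set` [set: 'I_n]%SET]) (X j @^-1` E j).
    apply/seteqP; split => w /=.
      move=> [H Bw] j _; have [->|ji] := eqVneq j i.
        by rewrite /E unlift_none.
      by apply: H; rewrite /= !inE.
    move=> H; split; first by move=> j _; apply: H; rewrite /= inE.
    by have := H i; rewrite /E unlift_none; apply; rewrite /= inE.
  rewrite !X_indep// (bigD1 i)//=; last by rewrite inE.
  rewrite {1}/E unlift_none; congr (_ * _).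
  by apply: eq_bigl => j; rewrite !inE.
- move=> _; rewrite (le_lt_trans (probability_le1 _ _)) ?ltry//.
  by apply: measurableI => //; rewrite preimage_setT.
Qed.

End independence_omit.

(** * Conditional law of a function of two independent variables *)

Section conditional_law.
Context d d1 d2 (T : measurableType d) (T1 : measurableType d1)
  (T2 : measurableType d2) (R : realType).
Variables (P : probability T R) (Z : {RV P >-> T1}) (X : {RV P >-> T2}).
Local Open Scope ereal_scope.

Hypothesis ZX_indep : forall A B, measurable A -> measurable B ->
  P (Z @^-1` A `&` X @^-1` B) = P (Z @^-1` A) * P (X @^-1` B).

(** Independence makes the joint law a product measure, which is computed by integrating the
    measures of sections. *)
Lemma joint_law_indep (C : set (T1 * T2)) : measurable C ->
  P [set w | C (Z w, X w)] =
  \int[distribution P Z]_z distribution P X [set x | C (z, x)].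
Proof.
move=> mC.
have mZX : measurable_fun [set: T] (fun w => (Z w, X w)).
  by apply: measurable_fun_pair; exact: measurable_funPT.
pose joint := pushforward_measure P mZX.
transitivity (joint C); first by [].
rewrite -(@product_measure_unique _ _ _ _ _ (distribution P Z)
  (distribution P X) joint)//.
apply: eq_integral => z _ /=; congr (distribution P X _).
by apply/seteqP; split => x /=; rewrite /xsection/= inE.
Qed.

Context d3 (T3 : measurableType d3).
Variables (Y : {RV P >-> T3}) (phi : T1 * T2 -> T3).
Hypothesis mphi : measurable_fun [set: T1 * T2] phi.
Hypothesis YE : forall w, Y w = phi (Z w, X w).

(** Named so that it can carry the measurable function structure that [distribution] expects. *)
Definition slice (z : T1) (x : T2) : T3 := phi (z, x).

Let measurable_slice z : measurable_fun [set: T2] (slice z).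
Proof.
by apply: (measurableT_comp mphi); exact: measurable_fun_pair.
Qed.

HB.instance Definition _ z :=
  isMeasurableFun.Build _ _ _ _ (slice z) (measurable_slice z).

(** With [Z] frozen at [z], independence leaves the law of [X] unchanged, so this is the candidate
    for the law of [Y] given [Z = z]. *)
Definition image_kernel (z : T1) : pprobability T3 R :=
  distribution (distribution P X) (slice z).

Lemma image_kernelE z B :
  image_kernel z B = distribution P X [set x | B (phi (z, x))].
Proof. by []. Qed.

Let measurable_preimage B : measurable B -> measurable [set u | B (phi u)].
Proof. by move=> mB; rewrite -[X in measurable X]setTI; exact: mphi. Qed.

(** The sigma-algebra on probability measures is generated by evaluations, and each evaluation is
    here the measure of a section of a measurable set. *)
Lemma measurable_image_kernel : measurable_fun [set: T1] image_kernel.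
Proof.
apply: (measurability (@pset _ _ _ : set (set (pprobability T3 R)))) => //.
move=> _ -[_ [r r01] [B mB <-]] <-; apply: emeasurable_fun_infty_o => //=.
have := @measurable_fun_xsection _ _ _ _ R (distribution P X) _
  (measurable_preimage mB).
apply: eq_measurable_fun => z _ /=.
congr (distribution P X _).
by apply/seteqP; split => x /=; rewrite /xsection/= inE.
Qed.

HB.instance Definition _ :=
  isMeasurableFun.Build _ _ _ _ image_kernel measurable_image_kernel.

Lemma is_cond_distribution_image_kernel :
  is_cond_distribution P Z Y image_kernel.
Proof.
move=> A B mA mB.
have -> : Z @^-1` A `&` Y @^-1` B =
    [set w | (A `*` [set: T2] `&` [set u | B (phi u)]) (Z w, X w)].
  by apply/seteqP; split => w /=; rewrite YE; tauto.
rewrite joint_law_indep; last first.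
  by apply: measurableI; [exact: measurableX|exact: measurable_preimage].
(* The section at [z] is empty off [A]; on [A] it is the set that [image_kernel z] measures. *)
rewrite [RHS]integral_mkcond; apply: eq_integral => z _; rewrite patchE.
case: ifPn => [/set_mem Az|/negP Az].
  rewrite image_kernelE; congr (distribution P X _).
  by apply/seteqP; split => x /=; tauto.
rewrite [C in distribution P X C](_ : _ = set0) ?measure0//.
by apply/seteqP; split => x //= -[[]] /mem_set.
Qed.

End conditional_law.

(** * Almost sure uniqueness of conditional laws *)

Section uniqueness.
Context (R : realType).
Local Open Scope ereal_scope.

(* The generating pi-system is countable: two kernels agreeing almost surely on
   each of its members are almost surely equal as measures. *)
Lemma measurable_rat_rays :
  @measurable _ R =
  <<s range (fun q : rat => `]-oo, ratr q[%classic : set R) >>.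
Proof.
set G := range _; apply/seteqP; split; last first.
  apply: smallest_sub; first exact: sigma_algebra_measurable.
  by move=> _ [q _ <-]; exact: measurable_itv.
have -> : @measurable _ R = (@RGenInftyO.G R).-sigma.-measurable.
  by rewrite -RGenInftyO.measurableE.
apply: smallest_sub; first exact: smallest_sigma_algebra.
move=> _ [x ->].
have -> : `]-oo, x[%classic = \bigcup_(q : rat)
    (if ratr q < x then `]-oo, ratr q[%classic else set0)%R.
  apply/seteqP; split => y /=.
    rewrite in_itv/= => /rat_in_itvoo[q]; rewrite in_itv/= => /andP[yq qx].
    by exists q => //; rewrite qx /= in_itv.
  move=> [q _]; case: ifP => //= qx; rewrite !in_itv/= => yq.
  exact: lt_trans qx.
apply: (@bigcupT_measurable_rat _ (g_sigma_algebraType G)) => q.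
by case: ifP => // qx; apply: sub_sigma_algebra; exists q.
Qed.

(** Rational rays are nested, hence form a pi-system, and those with natural endpoints exhaust the
    line. *)
Lemma probability_rat_rays_unique (mu nu : probability R R) :
  (forall q : rat, mu `]-oo, ratr q[%classic = nu `]-oo, ratr q[%classic) ->
  forall A, measurable A -> mu A = nu A.
Proof.
move=> H A mA; refine (@measure_unique _ R R
  _ (fun n : nat => `]-oo, ratr n%:R[%classic) measurable_rat_rays
  _ _ _ mu nu _ _ A mA).
- have rayI (p q : rat) : (p <= q)%R ->
      (`]-oo, ratr p[ `&` `]-oo, ratr q[ = `]-oo, ratr p[ :> set R)%classic.
    by move=> pq; apply/setIidPl/subset_itvl; rewrite bnd_simp ler_rat.
  move=> _ _ [p _ <-] [q _ <-]; have [pq|/ltW qp] := leP p q.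
    by rewrite rayI//; exists p.
  by rewrite setIC rayI//; exists q.
- by move=> n; exists n%:R.
- apply/seteqP; split => // x _; exists (Num.bound `|x|) => //=.
  by rewrite in_itv/= ratr_nat (le_lt_trans (ler_norm x))// archi_boundP.
- by move=> _ [q _ <-]; exact: H.
- by move=> n; rewrite (le_lt_trans (probability_le1 _ _)) ?ltry.
Qed.

Context d d1 (T : measurableType d) (T1 : measurableType d1).
Variables (P : probability T R) (Z : {RV P >-> T1}) (Y : {RV P >-> R}).

(** On a fixed ray the two kernels have equal integrals over every measurable set, hence agree off a
    null set; countably many rays give a single null set. *)
Lemma is_cond_distribution_ae_unique (k l : {mfun T1 >-> pprobability R R}) :
  is_cond_distribution P Z Y k -> is_cond_distribution P Z Y l ->
  \forall z \ae distribution P Z, forall B, measurable B -> k z B = l z B.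
Proof.
move=> kP lP.
have mk (h : {mfun T1 >-> pprobability R R}) B : measurable B ->
    measurable_fun [set: T1] (fun z => h z B).
  move=> mB; exact: (measurable_kernel (kprobability (measurable_funPT h))).
have ray q : \forall z \ae distribution P Z,
    k z `]-oo, ratr q[%classic = l z `]-oo, ratr q[%classic.
  have mq : measurable (`]-oo, ratr q[%classic : set R).
    exact: measurable_itv.
  have : ae_eq (distribution P Z) [set: T1]
      (fun z => k z `]-oo, ratr q[%classic)
      (fun z => l z `]-oo, ratr q[%classic).
    apply: integral_ae_eq => //.
    - apply/integrableP; split; first exact: mk.
      under eq_integral do rewrite gee0_abs//.
      by rewrite -kP// (le_lt_trans (probability_le1 _ _)) ?ltry//;
        apply: measurableI; exact: measurable_funPTI.
    - exact: mk.
    - by move=> E _ mE; rewrite -kP// -lP.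
  by apply: filterS => z; exact.
(* [unpickle] enumerates the rationals; the default 0 on integers coding none merely repeats a
   ray. *)
have := ae_foralln (fun n => ray (odflt 0%R (unpickle n))).
apply: filterS => z H; apply: probability_rat_rays_unique => q.
by have := H (pickle q); rewrite pickleK.
Qed.

(** The existence of [k] ensures that [xget] returns a genuine conditional law; the exceptional set,
    null for the law of [Z], pulls back to a [P]-null set. *)
Lemma cond_distribution_ae (k : {mfun T1 >-> pprobability R R}) :
  is_cond_distribution P Z Y k ->
  \forall w \ae P, forall B, measurable B ->
    cond_distribution P Z Y (Z w) B = k (Z w) B.
Proof.
move=> kP.
have cP : is_cond_distribution P Z Y (cond_distribution P Z Y).
  exact: (xgetPex _ (ex_intro _ k kP)).
have [N [mN N0 NP]] := is_cond_distribution_ae_unique cP kP.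
exists (Z @^-1` N); split => //; first exact: measurable_funPTI.
by move=> w /= H; apply: NP.
Qed.

End uniqueness.

(** * The linear Gaussian model *)

Section linear_gaussian.
Context {R : realType}.
Notation leb := (@lebesgue_measure R).

Lemma normal_prob_affine (a b m s : R) (B : set R) :
  a != 0 -> s != 0 -> measurable B ->
  normal_prob m s ((fun x => a * x + b) @^-1` B) =
  normal_prob (a * m + b) (a * s) B.
Proof.
move=> a0 s0 mB; rewrite /normal_prob.
(* Indicators turn both probabilities into integrals over the whole line, where the affine change of
   variables applies. *)
have mpatch (A : set R) (f : R -> R) : (\int[leb]_(x in A) (f x)%:E =
    \int[leb]_x ((\1_A x)%:E * (f x)%:E))%E.
  rewrite integral_mkcond; apply: eq_integral => x _; rewrite patchE indicE.
  by case: ifP => _; rewrite ?mul1e ?mul0e.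
rewrite [LHS]mpatch [RHS]mpatch (@ge0_integral_normal_pdf_affine _ a b m s)//.
by apply/measurable_EFinP; exact: measurable_indic.
Qed.

Lemma big_lift (n : nat) (i : 'I_n) (F : 'I_n -> R) :
  \sum_j F j = F i + \sum_(j < n.-1) F (lift i j).
Proof. by case: n i F => [[]//|n] i F; rewrite (bigD1_ord i). Qed.

(** The difference quotient equals [a i] for every nonzero increment. *)
Lemma derive_linear_form (n : nat) (a : 'I_n -> R) (g : 'rV[R]_n -> R)
    (gE : forall x, g x = \sum_(j < n) a j * x 0 j) (i : 'I_n) (x : 'rV[R]_n) :
  'D_(delta_mx 0 i) g x = a i.
Proof.
apply/cvg_lim => //; apply: cvg_near_cst; near=> h.
have h0 : h != 0 by near: h; exact: nbhs_dnbhs_neq.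
rewrite /= !gE -sumrB (bigD1 i)//= big1 ?addr0.
  rewrite !mxE !eqxx mulr1 -mulrBr addrK.
  by rewrite /GRing.scale/= mulrCA mulVf ?mulr1.
by move=> j ji; rewrite !mxE eqxx (negPf ji) mulr0 add0r subrr.
Unshelve. all: end_near. Qed.

Context disp (T : measurableType disp) (P : probability T R) (d : nat).
Variables (X : 'I_d -> {RV P >-> R}) (mu sigma : 'I_d -> R).
Hypothesis X_indep : mutually_independent P X.
Hypothesis sigma_gt0 : forall j, 0 < sigma j.
Hypothesis X_normal : forall j, normally_distributed P (X j) (mu j) (sigma j).
Variables (a : 'I_d -> R) (g : 'rV[R]_d -> R).
Hypothesis gE : forall x, g x = \sum_(j < d) a j * x 0 j.
Variables (Y : {RV P >-> R}).
Hypothesis YE : forall w, Y w = g (\row_j X j w).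
Variable (i : 'I_d).
Hypothesis ai_neq0 : a i != 0.

(** The part of [Y] due to the other inputs; [phi] rebuilds [Y] from them and [X i]. *)
Let h (z : d.-1.-tuple R) : R := \sum_(j < d.-1) a (lift i j) * tnth z j.
Let phi (u : d.-1.-tuple R * R) : R := a i * u.2 + h u.1.

Let measurable_phi : measurable_fun [set: d.-1.-tuple R * R] phi.
Proof.
have mh : measurable_fun [set: d.-1.-tuple R] h.
  apply: measurable_sum => j; apply: measurable_funM => //.
  exact: measurable_tnth.
apply: measurable_funD; first exact: measurable_funM.
exact: measurableT_comp mh measurable_fst.
Qed.

Let Y_phi w : Y w = phi (omit P X i w, X i w).
Proof.
rewrite YE gE (big_lift i) mxE; congr (_ + _); apply: eq_bigr => j _.
by rewrite mxE tnth_mktuple.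
Qed.

(** The other inputs only shift the mean. The deviation [a i * sigma i] keeps its sign, which is
    harmless since only its square enters the density. *)
Lemma cond_law_normal : \forall w \ae P, forall B, measurable B ->
  cond_distribution P (omit P X i) Y (omit P X i w) B =
  normal_prob (a i * mu i + h (omit P X i w)) (a i * sigma i) B.
Proof.
have indep := fun A B => @omit_indep _ _ _ _ _ P d X X_indep i A B.
have := cond_distribution_ae
  (is_cond_distribution_image_kernel indep measurable_phi Y_phi).
apply: filterS => w H B mB; rewrite H//=.
rewrite -(normal_prob_affine _ _ ai_neq0 _ mB) ?gt_eqF// -X_normal//.
by rewrite -[C in measurable C]setTI; exact: measurable_affine.
Qed.

Let as0 : a i * sigma i != 0.
Proof. by rewrite mulf_neq0// gt_eqF. Qed.

(** The conditional mean varies with the other inputs, but the entropy of a normal law does not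
    depend on its mean. *)
Lemma total_entropy_linear :
  total_entropy P X Y i =
  (ln (2 * pi * expR 1 * (a i * sigma i) ^+ 2) / 2)%:E.
Proof.
rewrite /total_entropy.
rewrite (@ae_eq_integral_nonmeasurable _ _ _ _ _
  (cst (ln (2 * pi * expR 1 * (a i * sigma i) ^+ 2) / 2)%:E)).
  by rewrite integral_cst//= probability_setT mule1.
by apply: filterS cond_law_normal => w H _; exact: diff_entropy_normal H.
Qed.

Lemma total_variance_linear :
  total_variance P X Y i = ((a i * sigma i) ^+ 2)%:E.
Proof.
rewrite /total_variance.
rewrite (@ae_eq_integral_nonmeasurable _ _ _ _ _
  (cst ((a i * sigma i) ^+ 2)%:E)).
  by rewrite integral_cst//= probability_setT mule1.
by apply: filterS cond_law_normal => w H _; exact: variance_normal H.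
Qed.

Lemma deriv_measure_linear : deriv_measure P X g i = (a i ^+ 2)%:E.
Proof.
rewrite /deriv_measure unlock.
under eq_integral do rewrite (derive_linear_form gE).
by rewrite integral_cst//= probability_setT mule1.
Qed.

Lemma entropy_input :
  entropy P (X i) = (ln (2 * pi * expR 1 * sigma i ^+ 2) / 2)%:E.
Proof.
apply: diff_entropy_normal; first by rewrite gt_eqF.
exact: X_normal.
Qed.

End linear_gaussian.

(** * The exponential identities and the equivalence of the two bounds *)

Theorem mainTheorem3 (R : realType) (disp : measure_display)
    (T : measurableType disp) (P : probability T R) (d : nat)
    (X : 'I_d -> {RV P >-> R}) (mu sigma : 'I_d -> R)
    (X_indep : mutually_independent P X)
    (sigma_gt0 : forall j, 0 < sigma j)
    (X_normal : forall j, normally_distributed P (X j) (mu j) (sigma j))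
    (a : 'I_d -> R) (g : 'rV[R]_d -> R)
    (gE : forall x, g x = \sum_(j < d) a j * x 0 j)
    (Y : {RV P >-> R}) (YE : forall w, Y w = g (\row_j X j w))
    (i : 'I_d) (ai_neq0 : a i != 0) :
  let H_T := total_entropy P X Y i in
  let V_T := total_variance P X Y i in
  let nu := deriv_measure P X g i in
  [/\ expeR (2%:E * H_T) = ((2 * pi * expR 1)%:E * V_T)%E,
      expeR (2%:E * entropy P (X i)) = (2 * pi * expR 1 * sigma i ^+ 2)%:E
    & (expeR (2%:E * H_T) <= expeR (2%:E * entropy P (X i)) * nu)%E <->
      (V_T <= (sigma i ^+ 2)%:E * nu)%E].
Proof.
move=> H_T V_T nu.
have c0 : 0 < 2 * pi * expR 1 :> R by rewrite !mulr_gt0 ?pi_gt0 ?expR_gt0.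
(* Used with [v] the conditional variance and with [v] the variance of the input; positivity makes
   [expR] invert [ln]. *)
have expH (v : R) : 0 < v ->
    expeR (2%:E * (ln (2 * pi * expR 1 * v) / 2)%:E) = (2 * pi * expR 1 * v)%:E.
  by move=> v0; rewrite -EFinM/= mulrC divfK// lnK// posrE mulr_gt0.
have VE : V_T = ((a i * sigma i) ^+ 2)%:E.
  exact: (total_variance_linear X_indep sigma_gt0 X_normal gE YE ai_neq0).
have HE : expeR (2%:E * H_T) = ((2 * pi * expR 1)%:E * V_T)%E.
  rewrite /H_T (total_entropy_linear X_indep sigma_gt0 X_normal gE YE ai_neq0).
  by rewrite VE expH ?exprn_even_gt0//= mulf_neq0// gt_eqF.
have XE : expeR (2%:E * entropy P (X i)) = (2 * pi * expR 1 * sigma i ^+ 2)%:E.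
  by rewrite (entropy_input sigma_gt0 X_normal) expH// exprn_gt0.
(* Both bounds become inequalities between real numbers, the first being the second multiplied by
   the positive constant [2 pi e]. *)
split=> //; rewrite HE XE VE /nu (deriv_measure_linear _ gE) -!EFinM !lee_fin.
by rewrite -(mulrA (2 * pi * expR 1)) ler_pM2l.
Qed.
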